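(* Let $X$ and $Y$ be topological spaces and let $\mathbf{q}=(q_\mu):Y\to\mathbf{Y}=(Y_\mu,q_{\mu\mu'},M)$ be an HPol-expansion of $Y$. For $F^*,G^*\in Sh^*(X,Y)$ let $d(F^*,G^* )=\{\mu\in M:q_\mu\circ F^*=q_\mu\circ G^*\}\in L(M)$, and for $\mu\in M$ and $F^*\in Sh^*(X,Y)$ put $B_{[\mu]}(F^* )=\{G^*\in Sh^*(X,Y): d(F^*,G^* )\le[\mu]\}$. Then the family $\{B_{[\mu]}(F^* ):F^*\in Sh^*(X,Y),\ \mu\in M\}$ is a basis for a topology on $Sh^*(X,Y)$. Moreover, this topology is independent of the chosen HPol-expansion of $Y$, and it coincides with the topology $T_{\mathbf{q}}$ on $Sh^*(X,Y)$ having as a basis the sets $V^{F^*}_\mu=\{G^*\in Sh^*(X,Y):q_\mu\circ F^*=q_\mu\circ G^*\}$, $F^*\in Sh^*(X,Y)$, $\mu\in M$.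
   Context: HTop is the homotopy category of topological spaces, HPol its full subcategory of spaces having the homotopy type of polyhedra. Inverse systems are indexed by directed sets. Lower classes. For a directed set $(M,\le)$, a subset $\Delta\subseteq M$ is a lower class if $\delta\in\Delta$, $\mu\in M$, $\mu\le\delta$ imply $\mu\in\Delta$. $L(M)$ is the set of all lower classes in $M$, partially ordered by $\Delta\le\Delta'$ iff $\Delta\supseteq\Delta'$. For $\mu\in M$, $[\mu]=\{\mu'\in M:\mu'\le\mu\}$ is the lower class generated by $\mu$. Pro$^*$-category. For inverse systems $\mathbf{X}=(X_\lambda,p_{\lambda\lambda'},\Lambda)$, $\mathbf{Y}=(Y_\mu,q_{\mu\mu'},M)$ in a category $\mathcal{T}$, an $S^*$-morphism $(f,f^n_\mu):\mathbf{X}\to\mathbf{Y}$ consists of a function $f:M\to\Lambda$ and $\mathcal{T}$-morphisms $f^n_\mu:X_{f(\mu)}\to Y_\mu$ ($n\in\mathbb{N},\mu\in M$) such that for all $\mu\le\mu'$ there are $\lambda\ge f(\mu),f(\mu')$ and $n\in\mathbb{N}$ with $q_{\mu\mu'}f^{n'}_{\mu'}p_{f(\mu')\lambda}=f^{n'}_\mu p_{f(\mu)\lambda}$ for all $n'\ge n$. Two such, $(f,f^n_\mu)$ and $(f',f'^n_\mu)$, are equivalent if for each $\mu\in M$ there are $\lambda\ge f(\mu),f'(\mu)$ and $n\in\mathbb{N}$ with $f^{n'}_\mu p_{f(\mu)\lambda}=f'^{n'}_\mu p_{f'(\mu)\lambda}$ for all $n'\ge n$. Composition: $(g,g^n_\nu)(f,f^n_\mu)=(fg,\,g^n_\nu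 f^n_{g(\nu)})$. The category pro$^*$-$\mathcal{T}$ has inverse systems as objects and equivalence classes $[(f,f^n_\mu)]$ as morphisms; pro-$\mathcal{T}$ is regarded as a subcategory by $f^n_\mu=f_\mu$ for all $n$. Expansions. An HPol-expansion of a space $X$ is a morphism $\mathbf{p}=(p_\lambda):X\to\mathbf{X}=(X_\lambda,p_{\lambda\lambda'},\Lambda)$ in pro-HTop with all $X_\lambda$ in HPol such that (E1) each morphism $h:X\to P$ of HTop with $P$ in HPol factors as $h=fp_\lambda$ for some $\lambda$ and $f:X_\lambda\to P$; (E2) if $f_0,f_1:X_\lambda\to P$, $P$ in HPol, satisfy $f_0p_\lambda=f_1p_\lambda$, then $f_0p_{\lambda\lambda'}=f_1p_{\lambda\lambda'}$ for some $\lambda'\ge\lambda$. Every space has an HPol-expansion, and any two are related by a unique isomorphism in pro-HPol compatible with the expansion morphisms. Coarse shape category $Sh^*$. Objects: topological spaces. A morphism $F^*:X\to Y$ is a class $\langle\mathbf{f}^*\rangle$ of pro$^*$-HPol morphisms $\mathbf{f}^*:\mathbf{X}\to\mathbf{Y}$ between HPol-expansions of $X$ and $Y$, where $\mathbf{f}^*:\mathbf{X}\to\mathbf{Y}$ and $\mathbf{f}'^*:\mathbf{X}'\to\mathbf{Y}'$ are identified if they correspond under the canonical isomorphisms $\mathbf{X}\cong\mathbf{X}'$, $\mathbf{Y}\cong\mathbf{Y}'$. Composition is by representatives. $Sh^*(X,Y)$ is the set of coarse shape morphisms $X\to Y$. A morphism $f:X\to Y$ of HTop induces a unique $\mathbf{f}:\mathbf{X}\to\mathbf{Y}$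 in pro-HPol compatible with the expansions, hence a coarse shape morphism $\mathcal{S}^*(f)$, again written $f$ in compositions such as $q_\mu\circ F^*$. *)

(* Defs.v *)
From HB Require Import structures.
From mathcomp Require Import all_boot all_order all_algebra.
From mathcomp Require Import finmap.
From mathcomp Require Import all_classical all_reals all_analysis.
From mathcomp Require Import lra.

Set Implicit Arguments.
Unset Strict Implicit.
Unset Printing Implicit Defensive.

Import Order.TTheory GRing.Theory Num.Theory.
Import numFieldNormedType.Exports.

Local Open Scope fset_scope.
Local Open Scope classical_set_scope.
Local Open Scope ring_scope.

(* Universe levels.  The class of all expansions of a space, hence also the   *)
(* collection Sh(X, Y) of coarse shape morphisms, lives one universe above    *)
(* topologicalType, whereas choiceType, set and {eq_quot _} only              *)
(* apply to types at the level of topologicalType.  This is why quotients and *)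
(* families of subsets of Sh(X, Y) are spelled out with plain predicates.     *)

Section Quotient.
Context {T : Type} (E : T -> T -> Prop).

Record equiv_rel : Prop := EquivRel {
  equiv_refl : forall x, E x x;
  equiv_sym : forall x y, E x y -> E y x;
  equiv_trans : forall x y z, E x y -> E y z -> E x z }.

Record quot : Type := Quot {
  qclass : T -> Prop;
  qclassP : exists x, qclass = E x }.

Definition cls (x : T) : quot := Quot (ex_intro _ x erefl).

Definition qrepr (c : quot) : T := projT1 (cid (qclassP c)).

Lemma quot_inj (c d : quot) : qclass c = qclass d -> c = d.
Proof.
case: c d => [c cP] [d dP] /= cd; subst d.
by congr Quot; apply: Prop_irrelevance.
Qed.

Lemma qreprK (c : quot) : cls (qrepr c) = c.
Proof. by apply: quot_inj; rewrite /= /qrepr; case: cid. Qed.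

Lemma clsP (eqE : equiv_rel) (x y : T) : cls x = cls y <-> E x y.
Proof.
split=> [/(congr1 qclass) /= ->|xy]; first exact: equiv_refl.
apply: quot_inj => /=; apply/funext => z; apply/propext; split.
- by apply: equiv_trans => //; apply: equiv_sym.
- exact: equiv_trans.
Qed.

Lemma qrepr_cls (eqE : equiv_rel) (x : T) : E (qrepr (cls x)) x.
Proof. by apply/clsP => //; rewrite qreprK. Qed.

End Quotient.

Record category := Category {
  obj :> Type;
  mor : obj -> obj -> Type;
  idm : forall A, mor A A;
  compm : forall A B D, mor B D -> mor A B -> mor A D;
  compmA : forall A B D E (h : mor D E) (g : mor B D) (f : mor A B),
    compm h (compm g f) = compm (compm h g) f;
  compm_idl : forall A B (f : mor A B), compm (idm B) f = f;
  compm_idr : forall A B (f : mor A B), compm f (idm A) = f }.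

Arguments mor {c} A B : simpl never.
Arguments idm {c} A : simpl never.
Arguments compm {c A B D} g f : simpl never.

Declare Scope cat_scope.
Delimit Scope cat_scope with cat.
Local Open Scope cat_scope.

Notation "g ∘ f" := (compm g f)
  (at level 40, left associativity) : cat_scope.

Definition isomorphic (C : category) (A B : C) : Prop :=
  exists (f : mor A B) (g : mor B A), g ∘ f = idm A /\ f ∘ g = idm B.

Definition homotopic (R : realType) (X Y : topologicalType)
    (f g : continuousType X Y) : Prop :=
  exists H : X * R -> Y,
    [/\ {within [set: X] `*` `[0%R, 1%R], continuous H},
        (forall x, H (x, 0%R) = f x) & (forall x, H (x, 1%R) = g x)].

Section Homotopy.
Context (R : realType).

Lemma continuous_pair (A B D : topologicalType) (f : A -> B) (g : A -> D) :
  continuous f -> continuous g -> continuous (fun x => (f x, g x)).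
Proof.
move=> cf cg x.
exact: (@cvg_pair _ _ _ _ (nbhs (f x)) (nbhs (g x)) _ _ _ f g (cf x) (cg x)).
Qed.

Lemma homotopy_precomp (X Z : topologicalType) (Y : topologicalType)
    (A : set X) (B : set Z) (f : X -> Y) (h : Z -> X) :
  {within A, continuous f} -> continuous h -> (forall z, B z -> A (h z)) ->
  {within B, continuous (f \o h)}.
Proof.
move=> /continuousP cf /continuousP ch BA; apply/continuousP => U oU.
have /open_subspaceP [V oV VE] := cf _ oU.
apply/open_subspaceP; exists (h @^-1` V); first exact: ch.
rewrite eqEsubset; split=> z /= [hz Bz]; split => //.
- have : (V `&` A) (h z) by split => //; apply: BA.
  by rewrite VE => -[].
- have : (f @^-1` U `&` A) (h z) by split => //; apply: BA.
  by rewrite -VE => -[].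
Qed.

Lemma in_cylinder (X : topologicalType) (a b : R) (z : X * R) :
  ([set: X] `*` `[a, b]) z <-> (a <= z.2 <= b)%R.
Proof. by split=> [[_ /=]|zab]; [|split => //=]; rewrite in_itv. Qed.

Lemma homotopic_equiv (X Y : topologicalType) :
  equiv_rel (@homotopic R X Y).
Proof.
have ctime (a b : R) : continuous (fun z : X * R => (z.1, a * z.2 + b)%R).
  apply: continuous_pair => z; first exact: cvg_fst.
  apply: cvgD; last exact: cvg_cst.
  by apply: cvgM; [exact: cvg_cst|exact: cvg_snd].
split.
- move=> f; exists (fun z => f z.1); split => //.
  apply: continuous_subspaceT => z.
  apply: (@continuous_comp _ _ _ fst f); first exact: cvg_fst.
  exact: cts_fun.
- move=> f g [H [cH H0 H1]].
  exists (H \o (fun z : X * R => (z.1, (-1) * z.2 + 1)%R)); split => /=.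
  + apply: homotopy_precomp cH (ctime _ _) _.
    move=> z /in_cylinder z01; apply/in_cylinder => /=; lra.
  + by move=> x; rewrite mulr0 add0r.
  + by move=> x; rewrite mulr1 addNr.
- move=> f g h [H [cH H0 H1]] [K [cK K0 K1]].
  pose L (z : X * R) := if (z.2 <= 2^-1)%R then H (z.1, (2 * z.2 + 0)%R)
                        else K (z.1, (2 * z.2 + (-1))%R).
  have cl (a b : R) : closed ([set: X] `*` `[a, b]).
    have -> : [set: X] `*` `[a, b] = snd @^-1` `[a, b].
      by apply/seteqP; split=> [z [] //|z ?]; split.
    by apply: closed_comp; [move=> ? _; exact: cvg_snd|exact: itv_closed].
  exists L; split.
  + have -> : [set: X] `*` `[0%R, 1%R] =
      ([set: X] `*` `[0%R, (2^-1 : R)%R]) `|`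
      ([set: X] `*` `[(2^-1 : R)%R, 1%R]).
      apply/seteqP; split=> [z /in_cylinder z01|z].
        have [zle|zgt] := leP z.2 (2^-1)%R; [left|right];
          apply/in_cylinder; lra.
      by move=> [] /in_cylinder z01; apply/in_cylinder; lra.
    apply: withinU_continuous; [exact: cl|exact: cl| |].
    * apply: (@subspace_eq_continuous _ _ _
        (H \o (fun z : X * R => (z.1, 2 * z.2 + 0)%R))).
        move=> z; rewrite inE => /in_cylinder z01.
        rewrite /from_subspace /L ifT //; lra.
      apply: homotopy_precomp cH (ctime _ _) _.
      move=> z /in_cylinder z01; apply/in_cylinder => /=; lra.
    * apply: (@subspace_eq_continuous _ _ _
        (K \o (fun z : X * R => (z.1, 2 * z.2 + (-1))%R))).
        move=> [x t]; rewrite inE => /in_cylinder /= t01.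
        rewrite /from_subspace /L /=; case: ifPn => // t2.
        have -> : (2 * t + 0 = 1 :> R)%R by lra.
        have -> : (2 * t - 1 = 0 :> R)%R by lra.
        by rewrite K0 H1.
      apply: homotopy_precomp cK (ctime _ _) _.
      move=> z /in_cylinder z01; apply/in_cylinder => /=; lra.
  + move=> x; rewrite /L ifT /=; last by lra.
    by rewrite mulr0 addr0 H0.
  + move=> x; rewrite /L ifF /=; last by apply/negbTE; lra.
    by have -> : (2 * 1 + -1 = 1 :> R)%R by lra.
Qed.

Lemma homotopic_comp (X Y Z : topologicalType)
    (f f' : continuousType X Y) (g g' : continuousType Y Z) :
  homotopic R f f' -> homotopic R g g' ->
  homotopic R (g \o f : continuousType X Z) (g' \o f' : continuousType X Z).
Proof.
move=> [H [cH H0 H1]] [K [cK K0 K1]].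
have hfg : homotopic R (g \o f : continuousType X Z)
                       (g \o f' : continuousType X Z).
  exists (g \o H); split => /=; [|by move=> x; rewrite H0|by move=> x; rewrite H1].
  move/continuousP: cH => cH; apply/continuousP => U oU.
  have /continuousP cg : continuous g by exact: cts_fun.
  exact: cH _ (cg _ oU).
apply: (equiv_trans (homotopic_equiv _ _)) hfg _.
exists (K \o (fun z : X * R => (f' z.1, z.2))); split => /=.
- apply: homotopy_precomp cK _ _; last by move=> z [_].
  apply: continuous_pair => z; last exact: cvg_snd.
  apply: (@continuous_comp _ _ _ fst f'); first exact: cvg_fst.
  exact: cts_fun.
- by move=> x; rewrite K0.
- by move=> x; rewrite K1.
Qed.

Definition hcls (X Y : topologicalType) (f : continuousType X Y) :
  quot (@homotopic R X Y) := cls _ f.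

Lemma hclsK (X Y : topologicalType) (f : quot (@homotopic R X Y)) :
  hcls (qrepr f) = f.
Proof. exact: qreprK. Qed.

Definition hcomp (X Y Z : topologicalType)
    (g : quot (@homotopic R Y Z)) (f : quot (@homotopic R X Y)) :
    quot (@homotopic R X Z) :=
  hcls (qrepr g \o qrepr f).

Lemma hcompE (X Y Z : topologicalType)
    (g : continuousType Y Z) (f : continuousType X Y) :
  hcomp (hcls g) (hcls f) = hcls (g \o f).
Proof.
apply/clsP; first exact: homotopic_equiv.
by apply: homotopic_comp; apply: qrepr_cls; exact: homotopic_equiv.
Qed.

Lemma hcompA (A B D E : topologicalType) (h : quot (@homotopic R D E))
    (g : quot (@homotopic R B D)) (f : quot (@homotopic R A B)) :
  hcomp h (hcomp g f) = hcomp (hcomp h g) f.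
Proof.
rewrite -[h]hclsK -[g]hclsK -[f]hclsK.
move: (qrepr h) (qrepr g) (qrepr f) => h' g' f'.
rewrite (hcompE g' f') (hcompE h' g') !hcompE.
by apply: (congr1 (@hcls _ _)); apply/continuousEP.
Qed.

Lemma hcomp1m (A B : topologicalType) (f : quot (@homotopic R A B)) :
  hcomp (hcls idfun) f = f.
Proof.
rewrite -[f]hclsK; move: (qrepr f) => f'; rewrite hcompE.
by apply: (congr1 (@hcls _ _)); apply/continuousEP.
Qed.

Lemma hcompm1 (A B : topologicalType) (f : quot (@homotopic R A B)) :
  hcomp f (hcls idfun) = f.
Proof.
rewrite -[f]hclsK; move: (qrepr f) => f'; rewrite hcompE.
by apply: (congr1 (@hcls _ _)); apply/continuousEP.
Qed.

Definition HTop : category :=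
  @Category topologicalType (fun X Y => quot (@homotopic R X Y))
    (fun X => hcls idfun) hcomp hcompA hcomp1m hcompm1.

End Homotopy.

Record simplicial_complex (V : choiceType) := SimplicialComplex {
  simplices : set {fset V};
  simplex_neq0 : ~ simplices fset0;
  simplex_face : forall s t : {fset V},
    simplices s -> (t `<=` s)%fset -> t != fset0 -> simplices t }.

(* Points of |K| are given by their barycentric coordinates. *)
Record realization (R : realType) (V : choiceType)
    (K : simplicial_complex V) := Realization {
  bary :> V -> R;
  baryP : exists2 s : {fset V}, simplices K s &
    [/\ forall v, (0 <= bary v)%R,
        forall v, v \notin s -> bary v = 0%R &
        (\sum_(v <- s) bary v = 1)%R] }.

HB.instance Definition _ (R : realType) (V : choiceType)
  (K : simplicial_complex V) := gen_eqMixin (realization R K).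
HB.instance Definition _ (R : realType) (V : choiceType)
  (K : simplicial_complex V) := gen_choiceMixin (realization R K).

Section Realization.
Context (R : realType) (V : choiceType) (K : simplicial_complex V).

Definition closed_simplex (s : {fset V}) : set (realization R K) :=
  [set a | forall v, v \notin s -> a v = 0%R].

(* The weak (coherent) topology: U is open iff its trace on each closed       *)
(* simplex |s|, a subset of the Euclidean space R^s, is relatively open.      *)
Definition weak_open (U : set (realization R K)) : Prop :=
  forall s, simplices K s -> forall a, closed_simplex s a -> U a ->
  exists2 e : R, (0 < e)%R & forall b, closed_simplex s b ->
    (forall v, v \in s -> `|a v - b v| < e)%R -> U b.

Lemma weak_openT : weak_open setT.
Proof. by move=> s _ a _ _; exists 1%R. Qed.

Lemma weak_openI : setI_closed weak_open.
Proof.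
move=> U W oU oW s Ks a sa [Ua Wa].
have [e e0 eU] := oU s Ks a sa Ua.
have [d d0 dW] := oW s Ks a sa Wa.
exists (Num.min e d); first by rewrite lt_min e0.
by move=> b sb ab; split; [apply: eU|apply: dW] => // v vs;
  have := ab v vs; rewrite lt_min => /andP[].
Qed.

Lemma weak_open_bigU (I : Type) (f : I -> set (realization R K)) :
  (forall i, weak_open (f i)) -> weak_open (\bigcup_i f i).
Proof.
move=> of_ s Ks a sa [i _ fia].
have [e e0 eU] := of_ i s Ks a sa fia.
by exists e => // b sb ab; exists i => //; apply: eU.
Qed.

HB.instance Definition _ :=
  isOpenTopological.Build (realization R K) weak_openT weak_openI weak_open_bigU.

End Realization.

Definition HPol (R : realType) (X : HTop R) : Prop :=
  exists (V : choiceType) (K : simplicial_complex V),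
    isomorphic X (realization R K : HTop R).

Local Open Scope order_scope.

Record inv_sys (C : category) := InvSys {
  idx_disp : Order.disp_t;
  idx : preorderType idx_disp;
  idx_inhabited : inhabited idx;
  idx_directed : forall i j : idx, exists2 k, i <= k & j <= k;
  term :> idx -> C;
  bond : forall i j : idx, i <= j -> mor (term j) (term i);
  bond_id : forall (i : idx) (h : i <= i), bond h = idm (term i);
  bond_comp : forall (i j k : idx) (h : i <= j) (h' : j <= k) (h'' : i <= k),
    bond h ∘ bond h' = bond h'' }.

Section ProStar.
Context (C : category).

(* Equality of the sequences u, v after restriction to a common later stage   *)
(* of X, from some n on.                                                      *)
Definition agree (X : inv_sys C) (P : C) (a b : idx X)
    (u : nat -> mor (X a) P) (v : nat -> mor (X b) P) : Prop :=
  exists (l : idx X) (ha : a <= l) (hb : b <= l) (n : nat),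
    forall n', (n <= n')%N -> u n' ∘ bond ha = v n' ∘ bond hb.

Lemma agree_refl (X : inv_sys C) (P : C) (a : idx X) (u : nat -> mor (X a) P) :
  agree u u.
Proof. by exists a, (lexx a), (lexx a), 0%N. Qed.

Lemma agree_sym (X : inv_sys C) (P : C) (a b : idx X)
  (u : nat -> mor (X a) P) (v : nat -> mor (X b) P) : agree u v -> agree v u.
Proof. by move=> [l [ha [hb [n H]]]]; exists l, hb, ha, n => n' /H. Qed.

Lemma agree_trans (X : inv_sys C) (P : C) (a b c : idx X)
    (u : nat -> mor (X a) P) (v : nat -> mor (X b) P) (w : nat -> mor (X c) P) :
  agree u v -> agree v w -> agree u w.
Proof.
move=> [l [ha [hb [n H]]]] [l' [hb' [hc [n' H']]]].
have [k lk l'k] := idx_directed l l'.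
exists k, (le_trans ha lk), (le_trans hc l'k), (maxn n n') => m.
rewrite geq_max => /andP[nm n'm].
rewrite -(bond_comp ha lk) -(bond_comp hc l'k) !compmA H // -H' //.
by rewrite -!compmA (bond_comp _ _ (le_trans hb lk)) (bond_comp _ _ (le_trans hb lk)).
Qed.

Lemma agree_post (X : inv_sys C) (P Q : C) (a b : idx X)
    (w : nat -> mor P Q)
    (u : nat -> mor (X a) P) (v : nat -> mor (X b) P) :
  agree u v -> agree (fun n => w n ∘ u n) (fun n => w n ∘ v n).
Proof.
move=> [l [ha [hb [n H]]]]; exists l, ha, hb, n => n' nn'.
by rewrite -!compmA H.
Qed.

Lemma agree_eq (X : inv_sys C) (P : C) (a : idx X)
    (u v : nat -> mor (X a) P) n :
  (forall n', (n <= n')%N -> u n' = v n') -> agree u v.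
Proof. by move=> H; exists a, (lexx a), (lexx a), n => n' /H ->. Qed.

Lemma agree_ext (X : inv_sys C) (P : C) (a b : idx X)
    (u u' : nat -> mor (X a) P) (v v' : nat -> mor (X b) P) :
  u =1 u' -> v =1 v' -> agree u v -> agree u' v'.
Proof. by move=> /funext <- /funext <-. Qed.

Record sstar (X Y : inv_sys C) := SStar {
  sidx : idx Y -> idx X;
  smap : forall (n : nat) (m : idx Y), mor (X (sidx m)) (Y m);
  smapP : forall (m m' : idx Y) (h : m <= m'),
    agree (fun n => bond h ∘ smap n m') (fun n => smap n m) }.

Definition sequiv (X Y : inv_sys C) (f f' : sstar X Y) : Prop :=
  forall m : idx Y, agree (fun n => smap f n m) (fun n => smap f' n m).

Lemma sequiv_equiv (X Y : inv_sys C) : equiv_rel (@sequiv X Y).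
Proof.
split=> [f m|f g fg m|f g h fg gh m]; first exact: agree_refl.
- exact: agree_sym.
- exact: agree_trans (gh m).
Qed.

Definition sid (X : inv_sys C) : sstar X X.
Proof.
refine (@SStar X X id (fun _ m => idm (X m)) _) => m m' h.
exists m', (lexx m'), h, 0%N => n _.
by rewrite compm_idl compm_idr bond_id compm_idr.
Defined.

Lemma scomp_subproof (X Y Z : inv_sys C) (g : sstar Y Z) (f : sstar X Y)
    (m m' : idx Z) (h : m <= m') :
  agree (fun n => bond h ∘ (smap g n m' ∘ smap f n (sidx g m')))
        (fun n => smap g n m ∘ smap f n (sidx g m)).
Proof.
have [l [h' [hm [n0 H]]]] := smapP g h.
apply: (@agree_trans _ _ _ _ _ _
          (fun n => bond h ∘ smap g n m' ∘ bond h' ∘ smap f n l)).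
  apply: agree_ext (agree_post (fun n => bond h ∘ smap g n m')
                               (agree_sym (smapP f h'))) => n /=;
  by rewrite !compmA.
apply: (@agree_trans _ _ _ _ _ _
          (fun n => smap g n m ∘ bond hm ∘ smap f n l)).
  by apply: (@agree_eq _ _ _ _ _ n0) => n nn; rewrite H.
by apply: agree_ext (agree_post (smap g ^~ m) (smapP f hm)) => n;
  rewrite ?compmA.
Qed.

Definition scomp (X Y Z : inv_sys C) (g : sstar Y Z) (f : sstar X Y) :
    sstar X Z :=
  @SStar X Z (fun m => sidx f (sidx g m))
    (fun n m => smap g n m ∘ smap f n (sidx g m)) (@scomp_subproof _ _ _ g f).

Lemma scomp_sequiv (X Y Z : inv_sys C) (g g' : sstar Y Z) (f f' : sstar X Y) :
  sequiv g g' -> sequiv f f' -> sequiv (scomp g f) (scomp g' f').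
Proof.
move=> gg ff m /=; have [l [h [h' [n0 H]]]] := gg m.
apply: (@agree_trans _ _ _ _ _ _
          (fun n => smap g n m ∘ bond h ∘ smap f n l)).
  by apply: agree_ext (agree_post (smap g ^~ m) (agree_sym (smapP f h))) => n;
    rewrite ?compmA.
apply: (@agree_trans _ _ _ _ _ _
          (fun n => smap g' n m ∘ bond h' ∘ smap f' n l)).
  apply: agree_trans (agree_post (fun n => smap g n m ∘ bond h) (ff l)) _.
  by apply: (@agree_eq _ _ _ _ _ n0) => n nn; rewrite H.
by apply: agree_ext (agree_post (smap g' ^~ m) (smapP f' h')) => n;
  rewrite ?compmA.
Qed.

Definition pscomp (X Y Z : inv_sys C) (g : quot (@sequiv Y Z))
    (f : quot (@sequiv X Y)) : quot (@sequiv X Z) :=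
  cls _ (scomp (qrepr g) (qrepr f)).

Lemma pscompE (X Y Z : inv_sys C) (g : sstar Y Z) (f : sstar X Y) :
  pscomp (cls _ g) (cls _ f) = cls _ (scomp g f).
Proof.
apply/clsP; first exact: sequiv_equiv.
by apply: scomp_sequiv; exact: (qrepr_cls (@sequiv_equiv _ _)).
Qed.

Lemma pscompA (X Y Z W : inv_sys C) (h : quot (@sequiv Z W))
    (g : quot (@sequiv Y Z)) (f : quot (@sequiv X Y)) :
  pscomp h (pscomp g f) = pscomp (pscomp h g) f.
Proof.
rewrite -[h]qreprK -[g]qreprK -[f]qreprK.
move: (qrepr h) (qrepr g) (qrepr f) => h' g' f'.
rewrite (pscompE g' f') (pscompE h' g') !pscompE.
apply/clsP; first exact: sequiv_equiv.
by move=> m /=; apply: (@agree_eq _ _ _ _ _ 0%N) => n _; rewrite /= compmA.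
Qed.

Lemma pscomp1m (X Y : inv_sys C) (f : quot (@sequiv X Y)) :
  pscomp (cls _ (sid Y)) f = f.
Proof.
rewrite -[f]qreprK; move: (qrepr f) => f'; rewrite pscompE.
apply/clsP; first exact: sequiv_equiv.
by move=> m /=; apply: (@agree_eq _ _ _ _ _ 0%N) => n _; rewrite /= compm_idl.
Qed.

Lemma pscompm1 (X Y : inv_sys C) (f : quot (@sequiv X Y)) :
  pscomp f (cls _ (sid X)) = f.
Proof.
rewrite -[f]qreprK; move: (qrepr f) => f'; rewrite pscompE.
apply/clsP; first exact: sequiv_equiv.
by move=> m /=; apply: (@agree_eq _ _ _ _ _ 0%N) => n _; rewrite /= compm_idr.
Qed.

Definition ProStar : category :=
  @Category (inv_sys C) (fun X Y => quot (@sequiv X Y))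
    (fun X => cls _ (sid X)) pscomp pscompA pscomp1m pscompm1.

Record promor (X Y : inv_sys C) := ProMor {
  pidx : idx Y -> idx X;
  pmap : forall m : idx Y, mor (X (pidx m)) (Y m);
  pmapP : forall (m m' : idx Y) (h : m <= m'),
    exists (l : idx X) (hl : pidx m' <= l) (hl' : pidx m <= l),
      bond h ∘ pmap m' ∘ bond hl = pmap m ∘ bond hl' }.

Lemma pro_incl_subproof (X Y : inv_sys C) (f : promor X Y)
    (m m' : idx Y) (h : m <= m') :
  agree (fun _ => bond h ∘ pmap f m') (fun _ => pmap f m).
Proof. by have [l [hl [hl' H]]] := pmapP f h; exists l, hl, hl', 0%N. Qed.

Definition pro_incl (X Y : inv_sys C) (f : promor X Y) :
    @mor ProStar X Y :=
  cls _ (@SStar X Y (pidx f) (fun _ m => pmap f m) (pro_incl_subproof f)).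

End ProStar.

Section Expansion.
Context (R : realType).
Local Notation HTop := (HTop R).

Record expansion (X : HTop) := Expansion {
  sys :> inv_sys HTop;
  sys_HPol : forall l, HPol (sys l);
  exp_proj : forall l : idx sys, mor X (sys l);
  exp_proj_bond : forall (l l' : idx sys) (h : l <= l'), bond h ∘ exp_proj l' = exp_proj l;
  expE1 : forall (P : HTop) (h : mor X P), HPol P ->
    exists (l : idx sys) (f : mor (sys l) P), h = f ∘ exp_proj l;
  expE2 : forall (P : HTop) (l : idx sys) (f0 f1 : mor (sys l) P), HPol P ->
    f0 ∘ exp_proj l = f1 ∘ exp_proj l ->
    exists (l' : idx sys) (h : l <= l'), f0 ∘ bond h = f1 ∘ bond h }.

Lemma expE2' (X P : HTop) (p : expansion X) (a b : idx p)
    (f0 : mor (p a) P) (f1 : mor (p b) P) : HPol P ->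
  f0 ∘ exp_proj a = f1 ∘ exp_proj b ->
  exists (l : idx p) (ha : a <= l) (hb : b <= l), f0 ∘ bond ha = f1 ∘ bond hb.
Proof.
move=> polP E; have [k ak bk] := idx_directed a b.
have [|l [kl H]] := @expE2 _ p P k (f0 ∘ bond ak) (f1 ∘ bond bk) polP.
  by rewrite -!compmA !exp_proj_bond.
exists l, (le_trans ak kl), (le_trans bk kl).
by rewrite -(bond_comp ak kl) -(bond_comp bk kl) !compmA.
Qed.

Definition induces (X Y : HTop) (p : expansion X) (q : expansion Y)
    (h : mor X Y) (f : promor p q) : Prop :=
  forall m : idx q, pmap f m ∘ exp_proj (pidx f m) = exp_proj m ∘ h.

Lemma induces_exists (X Y : HTop) (p : expansion X) (q : expansion Y)
    (h : mor X Y) : exists f : promor p q, induces h f.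
Proof.
have F (m : idx q) : {l : idx p & {f : mor (p l) (q m) | exp_proj m ∘ h = f ∘ exp_proj l}}.
  have /cid[l /cid[f fE]] := expE1 p (exp_proj m ∘ h) (sys_HPol m).
  by exists l, f.
unshelve eexists (@ProMor _ p q (fun m => projT1 (F m))
  (fun m => sval (projT2 (F m))) _).
- move=> m m' mm'; apply: expE2'; first exact: sys_HPol.
  case: (F m) => l [f /= <-]; case: (F m') => l' [f' /= E].
  by rewrite -compmA -E compmA exp_proj_bond.
- by move=> m /=; case: (F m) => l [f /= <-].
Qed.

Lemma induces_unique (X Y : HTop) (p : expansion X) (q : expansion Y)
    (h : mor X Y) (f f' : promor p q) :
  induces h f -> induces h f' -> pro_incl f = pro_incl f'.
Proof.
move=> hf hf'; apply/clsP; first exact: sequiv_equiv.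
move=> m /=; have [|l [ha [hb H]]] := @expE2' _ _ p _ _ (pmap f m) (pmap f' m)
  (sys_HPol m); first by rewrite hf hf'.
by exists l, ha, hb, 0%N.
Qed.

Definition induced (X Y : HTop) (p : expansion X) (q : expansion Y)
    (h : mor X Y) : @mor (ProStar HTop) p q :=
  pro_incl (projT1 (cid (induces_exists p q h))).

Lemma inducedE (X Y : HTop) (p : expansion X) (q : expansion Y)
    (h : mor X Y) (f : promor p q) : induces h f -> induced p q h = pro_incl f.
Proof.
move=> hf; rewrite /induced; case: cid => g hg /=.
exact: induces_unique hg hf.
Qed.

Lemma induced_id (X : HTop) (p : expansion X) :
  induced p p (idm X) = idm (p : ProStar HTop).
Proof.
have H (m m' : idx p) (h : m <= m') :
    exists (l : idx p) (hl : m' <= l) (hl' : m <= l),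
      bond h ∘ idm (p m') ∘ bond hl = idm (p m) ∘ bond hl'.
  exists m', (lexx m'), h.
  by rewrite compm_idr compm_idl bond_id compm_idr.
rewrite (@inducedE _ _ _ _ _ (@ProMor _ p p id (fun m => idm _) H)).
  apply/clsP; first exact: sequiv_equiv.
  by move=> m /=; apply: (@agree_eq _ _ _ _ _ _ 0%N).
by move=> m /=; rewrite compm_idl compm_idr.
Qed.

Lemma induced_comp (X Y Z : HTop) (p : expansion X) (q : expansion Y)
    (r : expansion Z) (g : mor Y Z) (f : mor X Y) :
  induced q r g ∘ induced p q f = induced p r (g ∘ f).
Proof.
rewrite /induced; case: (cid (induces_exists q r g)) => g' hg.
case: (cid (induces_exists p q f)) => f' hf /=.
have H (m m' : idx r) (h : m <= m') :
    exists (l : idx p) (hl : pidx f' (pidx g' m') <= l)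
        (hl' : pidx f' (pidx g' m) <= l),
      bond h ∘ (pmap g' m' ∘ pmap f' (pidx g' m')) ∘ bond hl =
      (pmap g' m ∘ pmap f' (pidx g' m)) ∘ bond hl'.
  apply: expE2'; first exact: sys_HPol.
  rewrite -!compmA !hf [pmap g' m' ∘ _]compmA [pmap g' m ∘ _]compmA !hg.
  by rewrite !compmA exp_proj_bond.
rewrite -/(induced p r _).
rewrite (@inducedE _ _ _ _ _ (ProMor H)); last first.
  by move=> m /=; rewrite -compmA hf compmA hg compmA.
rewrite [LHS]pscompE; apply/clsP; first exact: sequiv_equiv.
by move=> m /=; apply: (@agree_eq _ _ _ _ _ _ 0%N).
Qed.

(* A space in HPol, seen as a system indexed by a point, expands itself. *)
Section Rudimentary.
Context (P : HTop) (polP : HPol P).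

Definition rudimentary : inv_sys HTop.
Proof.
refine (@InvSys HTop _ 'I_1 (inhabits ord0) _ (fun _ => P) (fun _ _ _ => idm P)
  _ _) => //.
- by move=> i j; exists ord0; rewrite !ord1.
- by move=> *; rewrite compm_idl.
Defined.

Definition rudimentary_expansion : expansion P.
Proof.
refine (@Expansion P rudimentary (fun _ => polP) (fun _ => idm P) _ _ _).
- by move=> l l' h; rewrite compm_idl.
- by move=> Q h _; exists ord0, h; rewrite compm_idr.
- move=> Q l f0 f1 _; rewrite !compm_idr => ->.
  by exists l, (lexx l).
Defined.

End Rudimentary.

End Expansion.

Section CoarseShape.
Context (R : realType).
Local Notation HTop := (HTop R).

Definition canon (X : HTop) (p p' : expansion X) :
  @mor (ProStar HTop) p p' := induced p p' (idm X).

(* HPol being a full subcategory of HTop, morphisms of pro*-HPol are morphisms *)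
(* of pro*-HTop between systems of spaces in HPol.                            *)
Record sh_rep (X Y : HTop) := ShRep {
  sh_dom : expansion X;
  sh_cod : expansion Y;
  sh_map : @mor (ProStar HTop) sh_dom sh_cod }.

Definition sh_equiv (X Y : HTop) (f f' : sh_rep X Y) : Prop :=
  canon (sh_cod f) (sh_cod f') ∘ sh_map f =
  sh_map f' ∘ canon (sh_dom f) (sh_dom f').

Lemma canon_trans (X : HTop) (p p' p'' : expansion X) :
  canon p' p'' ∘ canon p p' = canon p p''.
Proof. by rewrite /canon induced_comp compm_idl. Qed.

Lemma canon_refl (X : HTop) (p : expansion X) :
  canon p p = idm (p : ProStar HTop).
Proof. exact: induced_id. Qed.

Lemma sh_equivP (X Y : HTop) (f f' : sh_rep X Y) : sh_equiv f f' <->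
  sh_map f' =
  canon (sh_cod f) (sh_cod f') ∘ sh_map f ∘ canon (sh_dom f') (sh_dom f).
Proof.
rewrite /sh_equiv; split => [->|->].
- by rewrite -compmA canon_trans canon_refl compm_idr.
- by rewrite -!compmA canon_trans canon_refl compm_idr.
Qed.

Lemma sh_equiv_equiv (X Y : HTop) : equiv_rel (@sh_equiv X Y).
Proof.
split.
- by move=> f; rewrite /sh_equiv !canon_refl compm_idl compm_idr.
- move=> f g /sh_equivP E; apply/sh_equivP; rewrite E !compmA canon_trans.
  by rewrite -compmA canon_trans !canon_refl compm_idr compm_idl.
- move=> f g h /sh_equivP E /sh_equivP E'; apply/sh_equivP; rewrite E' E.
  by rewrite !compmA canon_trans -compmA canon_trans.
Qed.

Definition Sh (X Y : HTop) : Type := quot (@sh_equiv X Y).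

Definition sh_rep_comp (X Y Z : HTop) (g : sh_rep Y Z) (f : sh_rep X Y) :
    sh_rep X Z :=
  ShRep (sh_map g ∘ canon (sh_cod f) (sh_dom g) ∘ sh_map f).

Lemma sh_rep_comp_equiv (X Y Z : HTop) (g g' : sh_rep Y Z) (f f' : sh_rep X Y) :
  sh_equiv g g' -> sh_equiv f f' ->
  sh_equiv (sh_rep_comp g f) (sh_rep_comp g' f').
Proof.
move=> /sh_equivP E /sh_equivP E'; apply/sh_equivP => /=; rewrite E E'.
by rewrite !compmA -[_ ∘ canon _ _ ∘ canon _ _]compmA canon_trans
  -[_ ∘ canon _ _ ∘ canon _ _]compmA canon_trans.
Qed.

Definition sh_comp (X Y Z : HTop) (G : Sh Y Z) (F : Sh X Y) : Sh X Z :=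
  cls _ (sh_rep_comp (qrepr G) (qrepr F)).

Lemma sh_compE (X Y Z : HTop) (g : sh_rep Y Z) (f : sh_rep X Y) :
  sh_comp (cls _ g) (cls _ f) = cls _ (sh_rep_comp g f).
Proof.
apply/clsP; first exact: sh_equiv_equiv.
by apply: sh_rep_comp_equiv; apply: qrepr_cls; exact: sh_equiv_equiv.
Qed.

(* The coarse shape morphism of h : X -> Y in HTop; by sh_ofE the class does  *)
(* not depend on the expansions used to compute it.                           *)
Definition sh_of (X Y : HTop) (p : expansion X) (q : expansion Y)
    (h : mor X Y) : Sh X Y :=
  cls _ (ShRep (induced p q h)).

Lemma sh_ofE (X Y : HTop) (p p' : expansion X) (q q' : expansion Y)
    (h : mor X Y) : sh_of p q h = sh_of p' q' h.
Proof.
apply/clsP; first exact: sh_equiv_equiv.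
by rewrite /sh_equiv /canon /= !induced_comp compm_idl compm_idr.
Qed.

End CoarseShape.

Section LowerClass.
Context {disp : Order.disp_t} (M : preorderType disp).

Definition lower_classes : set (set M) :=
  [set D | forall d m : M, D d -> m <= d -> D m].

Definition lower_le (D D' : set M) : Prop := (D' `<=` D)%classic.

Definition lower_gen (m : M) : set M := [set m' | m' <= m].

End LowerClass.

Section Topology.
Context {T : Type}.

Definition set_family := (T -> Prop) -> Prop.

Definition set_family_union (S : set_family) : T -> Prop :=
  fun x => exists2 U, S U & U x.

(* The empty set is the union of the empty family. *)
Definition is_topology (O : set_family) : Prop :=
  [/\ O (fun _ => True),
      forall U W, O U -> O W -> O (fun x => U x /\ W x) &
      forall S : set_family, (forall U, S U -> O U) -> O (set_family_union S)].

Definition generated_topology (B : set_family) : set_family :=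
  fun U => exists2 S : set_family, (forall W, S W -> B W) & U = set_family_union S.

Definition is_basis (B : set_family) : Prop := is_topology (generated_topology B).

End Topology.
Arguments set_family : clear implicits.

Section CoarseShapeTopology.
Context (R : realType) (X Y : HTop R) (q : expansion Y).

Definition sh_proj (m : idx q) : Sh Y (q m) :=
  sh_of q (rudimentary_expansion (sys_HPol m)) (exp_proj m).

Definition sh_d (F G : Sh X Y) : set (idx q) :=
  [set m | sh_comp (sh_proj m) F = sh_comp (sh_proj m) G].

Definition sh_B (m : idx q) (F : Sh X Y) : Sh X Y -> Prop :=
  fun G => lower_le (sh_d F G) (lower_gen m).

Definition sh_V (m : idx q) (F : Sh X Y) : Sh X Y -> Prop :=
  fun G => sh_comp (sh_proj m) F = sh_comp (sh_proj m) G.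

Definition sh_B_family : set_family (Sh X Y) :=
  fun U => exists (F : Sh X Y) (m : idx q), U = sh_B m F.

Definition sh_V_family : set_family (Sh X Y) :=
  fun U => exists (F : Sh X Y) (m : idx q), U = sh_V m F.

End CoarseShapeTopology.

Arguments sh_proj {R Y} q m.
Arguments sh_d {R X Y} q F G.
Arguments sh_B {R X Y} q m F G.
Arguments sh_V {R X Y} q m F G.
Arguments sh_B_family {R} X {Y} q U.
Arguments sh_V_family {R} X {Y} q U.

(* Main.v *)
Require Import Defs.
From mathcomp Require Import all_boot all_order all_algebra.
From mathcomp Require Import all_classical all_reals all_analysis.

(* The sets V_m(F) are the classes of an equivalence relation that gets finer *)
(* as m grows, so U is open iff every x in U has some V_m(x) inside U; since  *)
(* the index set is directed, such sets are closed under intersection.        *)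
(* Functoriality of HTop -> Sh* makes d(F, G) a lower class, whence           *)
(* B_[m](F) = V_m(F); with (E1), which factors q_m through some q'_m', it     *)
(* also makes V'_m'(F) a subset of V_m(F), whence independence of q.          *)

Set Implicit Arguments.
Unset Strict Implicit.
Unset Printing Implicit Defensive.

Import Order.TTheory.
Local Open Scope cat_scope.
Local Open Scope order_scope.

(** Everything reduces to [sh_V_factor]: if the projection to one term factors through the
    projection to another, agreement of F and G at the latter forces agreement at the former.
    Bonding maps as factors give [sh_V_le], hence [sh_BE] and [sh_V_is_basis]; factors supplied by
    (E1) give [sh_V_generated_sub], which compares two expansions. *)

Lemma generated_topologyP (T : Type) (B : set_family T) (U : T -> Prop) :
  generated_topology B U <->
  forall x, U x -> exists W, [/\ B W, W x & forall y, W y -> U y].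
Proof.
split=> [[S SB ->] x [W SW Wx]|H].
  by exists W; split; [exact: SB| |move=> y Wy; exists W].
(* The largest possible family: all members of [B] inside [U]. *)
exists (fun W => B W /\ forall y, W y -> U y); first by move=> W [].
apply/funext => x; apply/propext; split=> [/H [W [BW Wx WU]]|[W [_ WU] /WU //]].
by exists W.
Qed.

Lemma is_basisP (T : Type) (B : set_family T) :
  (forall x, exists2 W, B W & W x) ->
  (forall U W x, B U -> B W -> U x -> W x ->
     exists V, [/\ B V, V x & forall y, V y -> U y /\ W y]) ->
  is_basis B.
Proof.
move=> cover inter; split.
- by apply/generated_topologyP => x _; have [W BW Wx] := cover x; exists W.
- move=> U W /generated_topologyP oU /generated_topologyP oW.
  apply/generated_topologyP => x [/oU [U' [BU U'x U'U]] /oW [W' [BW W'x W'W]]].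
  have [V [BV Vx VUW]] := inter _ _ _ BU BW U'x W'x.
  by exists V; split=> // y /VUW [/U'U ? /W'W].
- move=> S oS; apply/generated_topologyP => x [U SU Ux].
  have /generated_topologyP /(_ x Ux) [W [BW Wx WU]] := oS U SU.
  by exists W; split=> // y Wy; exists U => //; exact: WU.
Qed.

Section CoarseShapeCategory.
Context (R : realType).

Lemma sh_compA (X Y Z W : HTop R) (H : Sh Z W) (G : Sh Y Z) (F : Sh X Y) :
  sh_comp H (sh_comp G F) = sh_comp (sh_comp H G) F.
Proof.
rewrite -[H]qreprK -[G]qreprK -[F]qreprK.
rewrite (sh_compE (qrepr G)) (sh_compE (qrepr H)) !sh_compE.
by congr (cls _ (@ShRep _ _ _ _ _ _)); rewrite /= !compmA.
Qed.

(** The middle expansions may differ because [sh_of] does not depend on them; once they are made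
    equal, the canonical isomorphism between them is the identity. *)
Lemma sh_of_comp (X Y Z : HTop R) (p : expansion X) (q q' : expansion Y)
    (r : expansion Z) (g : mor Y Z) (f : mor X Y) :
  sh_comp (sh_of q' r g) (sh_of p q f) = sh_of p r (g ∘ f).
Proof.
rewrite (sh_ofE q' q r r) sh_compE.
congr (cls _ (@ShRep _ _ _ _ _ _)).
by rewrite /= canon_refl compm_idr induced_comp.
Qed.

Section Neighbourhoods.
Context (X Y : HTop R).

Lemma sh_V_factor (q q' : expansion Y) (m : idx q) (m' : idx q')
    (f : mor (q' m') (q m)) (F G : Sh X Y) :
  exp_proj m = f ∘ exp_proj m' -> sh_V q' m' F G -> sh_V q m F G.
Proof.
move=> mE FG.
have projE : sh_proj q m = sh_comp (sh_of (rudimentary_expansion (sys_HPol m'))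
    (rudimentary_expansion (sys_HPol m)) f) (sh_proj q' m').
  by rewrite /sh_proj mE sh_of_comp; exact: sh_ofE.
by rewrite /sh_V projE -!sh_compA FG.
Qed.

Lemma sh_V_le (q : expansion Y) (m m' : idx q) (F G : Sh X Y) :
  m <= m' -> sh_V q m' F G -> sh_V q m F G.
Proof. by move=> mm'; exact: sh_V_factor (esym (exp_proj_bond mm')). Qed.

Lemma sh_BE (q : expansion Y) (m : idx q) (F : Sh X Y) :
  sh_B q m F = sh_V q m F.
Proof.
(* One direction evaluates the inclusion at [m] itself; the other uses that [sh_d] is a lower
   class. *)
apply/funext => G; apply/propext; split=> [H|FG m' m'm].
  exact: (H m (lexx m)).
exact: sh_V_le m'm FG.
Qed.

Lemma sh_B_familyE (q : expansion Y) : sh_B_family X q = sh_V_family X q.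
Proof.
by apply/funext => U; apply/propext; split=> -[F [m ->]]; exists F, m;
  rewrite sh_BE.
Qed.

Lemma sh_V_is_basis (q : expansion Y) : is_basis (sh_V_family X q).
Proof.
apply: is_basisP.
  by move=> F; have [m] := idx_inhabited q; exists (sh_V q m F) => //; exists F, m.
move=> _ _ F [G [m ->]] [G' [m' ->]] GF G'F.
have [k mk m'k] := idx_directed m m'.
(* Any point of a class serves as its centre, so both sets can be recentred at [F]. *)
exists (sh_V q k F); split=> //; first by exists F, k.
by move=> H FH; split; [rewrite /sh_V GF|rewrite /sh_V G'F]; apply: sh_V_le FH.
Qed.

(** One inclusion suffices, as [q] and [q'] play symmetric roles. *)
Lemma sh_V_generated_sub (q q' : expansion Y) (U : Sh X Y -> Prop) :
  generated_topology (sh_V_family X q) U ->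
  generated_topology (sh_V_family X q') U.
Proof.
move=> /generated_topologyP oU; apply/generated_topologyP => F.
move=> /oU [_ [[G [m ->]] GF VU]].
have [m' [f mE]] := expE1 q' (exp_proj m) (sys_HPol m).
exists (sh_V q' m' F); split=> //; first by exists F, m'.
by move=> H FH; apply: VU; rewrite /sh_V GF; apply: sh_V_factor mE FH.
Qed.

End Neighbourhoods.
End CoarseShapeCategory.

Theorem proposition3p9 (R : realType) (X Y : HTop R) (q : expansion Y) :
  [/\ (forall F G : Sh X Y, lower_classes (sh_d q F G)),
      is_basis (sh_B_family X q),
      (forall q' : expansion Y,
         generated_topology (sh_B_family X q') = generated_topology (sh_B_family X q)),
      is_basis (sh_V_family X q) &
      generated_topology (sh_B_family X q) = generated_topology (sh_V_family X q)].
Proof.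
split; rewrite ?sh_B_familyE //; try exact: sh_V_is_basis.
- by move=> F G d m FG md; exact: sh_V_le md FG.
- move=> q'; rewrite sh_B_familyE; apply/funext => U; apply/propext.
  by split; apply: sh_V_generated_sub.
Qed.
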